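(* Assume the Lyapunov exponent $L:\mathbb{R}\to[0,\infty)$ is continuous. Then $L$ attains its minimum on $\mathbb{R}$, and for $P$-almost every $\omega\in\Omega$, $$0\le\liminf_{N\to\infty}\left(-\frac1N\log\mathcal{I}(N,\omega)\right)\le\limsup_{N\to\infty}\left(-\frac1N\log\mathcal{I}(N,\omega)\right)\le2\min_{E\in\mathbb{R}}L(E).$$
   Context: Let $(\Omega,\mathcal F,P)$ be a probability space and $\phi:\Omega\to\Omega$ a measurable bijection with measurable inverse that preserves $P$ and is ergodic (every $\phi$-invariant measurable set has probability $0$ or $1$). Let $f:\Omega\to\mathbb{R}$ be bounded and measurable, and put $v_\omega(n)=f(\phi^n\omega)$, $n\in\mathbb{Z}$. For $E\in\mathbb{R}$ let $T_{N,\omega}(E)=A_{N,\omega}(E)\cdots A_{1,\omega}(E)$ with $A_{n,\omega}(E)=\begin{pmatrix}v_\omega(n)-E&-1\\1&0\end{pmatrix}$; $\|\cdot\|$ is the operator norm. The Lyapunov exponent is $L(E)=\lim_{N\to\infty}\frac1N\int_\Omega\log\|T_{N,\omega}(E)\|\,dP(\omega)=\inf_{N\ge1}\frac1N\int_\Omega\log\|T_{N,\omega}(E)\|\,dP(\omega)$. Define $\mathcal{I}(N,\omega)=\int_{-\infty}^{\infty}\frac{dE}{\|T_{N,\omega}(E)\|^2}$. *)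

(* Defs.v *)
From HB Require Import structures.
From mathcomp Require Import all_boot all_order all_algebra.
From mathcomp Require Import all_classical all_reals all_analysis.
Set Implicit Arguments. Unset Strict Implicit. Unset Printing Implicit Defensive.
Import Order.TTheory GRing.Theory Num.Theory.
Import numFieldNormedType.Exports.
Local Open Scope classical_set_scope.
Local Open Scope ring_scope.

Section Defs.
Context {R : realType}.

Definition vnorm2 (v : 'cV[R]_2) : R := Num.sqrt (v 0 0 ^+ 2 + v 1 0 ^+ 2).

Definition opnorm2 (A : 'M[R]_2) : R :=
  sup [set vnorm2 (A *m v) | v in [set v : 'cV[R]_2 | vnorm2 v = 1]].

Definition transfer_step (a E : R) : 'M[R]_2 :=
  \matrix_(i < 2, j < 2)
    (if i == 0 then (if j == 0 then a - E else -1)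
     else (if j == 0 then 1 else 0)).

Context {T : Type}.

Definition potential (phi : T -> T) (f : T -> R) (w : T) (n : nat) : R :=
  f (iter n phi w).

Fixpoint transfer (phi : T -> T) (f : T -> R) (N : nat) (w : T) (E : R)
  : 'M[R]_2 :=
  match N with
  | 0 => 1%:M
  | N'.+1 => transfer_step (potential phi f w N'.+1) E *m transfer phi f N' w E
  end.

End Defs.

Section Lyap.
Context {R : realType} {d : measure_display} {Omega : measurableType d}.
Variable (P : probability Omega R) (phi : Omega -> Omega) (f : Omega -> R).

(* L(E) = inf_{N >= 1} (1/N) \int log ||T_N(E)|| dP
   (equal to the limit, as stated in the context) *)
Definition lyapunov (E : R) : R :=
  inf [set (N.+1%:R)^-1 *
           fine (\int[P]_w (ln (opnorm2 (transfer phi f N.+1 w E)))%:E)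
      | N in [set: nat]].

Definition Ical (N : nat) (w : Omega) : \bar R :=
  (\int[@lebesgue_measure R]_(E in [set: R])
     ((opnorm2 (transfer phi f N w E)) ^- 2)%:E)%E.

(* the sequence  N |-> -(1/N) log I(N, omega) ;  I(N,omega) is finite
   for N >= 1, only the tail matters *)
Definition decay_seq (w : Omega) (N : nat) : R :=
  - ((N%:R)^-1 * ln (fine (Ical N w))).

End Lyap.

(* Main.v *)
Require Import Defs.
From HB Require Import structures.
From mathcomp Require Import all_boot all_order all_algebra.
From mathcomp Require Import all_classical all_reals all_analysis.
From mathcomp Require Import ring lra zify measurable_realfun.
Import Order.TTheory GRing.Theory Num.Theory.
Import numFieldNormedType.Exports.
Local Open Scope classical_set_scope.
Local Open Scope ring_scope.

(* Since ||T_N|| >= 1 everywhere and ||T_N(E)|| >= (|E| - M - 1)^N for large |E|,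
   I(N) is bounded uniformly in N >= 1, which gives the lower bound, and L is
   coercive, hence attains its minimum at some E0.
   For the upper bound, fix n with (1/n) \int log||T_n(E0)|| dP close to L(E0).
   The function E |-> log||T_n(E)|| is Lipschitz near E0 uniformly in omega, so
   subadditivity bounds n log||T_N(E)||, uniformly for |E - E0| <= r, by the
   Birkhoff sum over N iterates of log||T_n(E0)|| + small, up to a constant.  The
   upper half of the ergodic theorem (Garsia's maximal argument) then gives
   ||T_N(E)|| <= exp(C + N (L(E0) + e)) on the whole interval, whence
   I(N) >= 2 r exp(- 2 C - 2 N (L(E0) + e)). *)

(** * Operator norm of real 2x2 matrices *)

Section OperatorNorm.
Context {R : realType}.
Implicit Types (A B : 'M[R]_2) (u v : 'cV[R]_2).

Lemma sum_ord2 (F : 'I_2 -> R) : \sum_i F i = F 0 + F 1.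
Proof. by rewrite !big_ord_recl big_ord0 addr0; congr (_ + F _); apply/val_inj. Qed.

Lemma ord2P (i : 'I_2) : i = 0 \/ i = 1.
Proof. by case: i => [[|[|//]]] ?; [left|right]; apply/val_inj. Qed.

Lemma mul2mxE (n : nat) A (B : 'M[R]_(2, n)) i j :
  (A *m B) i j = A i 0 * B 0 j + A i 1 * B 1 j.
Proof. by rewrite mxE sum_ord2. Qed.

Lemma det2E A : \det A = A 0 0 * A 1 1 - A 0 1 * A 1 0.
Proof.
rewrite (expand_det_row _ 0) sum_ord2 /cofactor !det_mx11 !mxE /=.
have -> : lift 0 0 = 1 :> 'I_2 by apply/val_inj.
have -> : lift 1 0 = 0 :> 'I_2 by apply/val_inj.
by rewrite expr0 expr1; ring.
Qed.

Lemma vnorm2_ge0 v : 0 <= vnorm2 v. Proof. exact: sqrtr_ge0. Qed.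

Lemma vnorm2_sqr v : vnorm2 v ^+ 2 = v 0 0 ^+ 2 + v 1 0 ^+ 2.
Proof. by rewrite sqr_sqrtr// addr_ge0 ?sqr_ge0. Qed.

Lemma vnorm2_le v c : 0 <= c -> v 0 0 ^+ 2 + v 1 0 ^+ 2 <= c ^+ 2 -> vnorm2 v <= c.
Proof.
by move=> c0 h; rewrite -(ler_pXn2r (ltn0Sn 1)) ?nnegrE ?vnorm2_ge0// vnorm2_sqr.
Qed.

Lemma vnorm2Z a v : vnorm2 (a *: v) = `|a| * vnorm2 v.
Proof.
by rewrite /vnorm2 !mxE !exprMn -mulrDr sqrtrM ?sqr_ge0// sqrtr_sqr.
Qed.

Lemma vnorm2D u v : vnorm2 (u + v) <= vnorm2 u + vnorm2 v.
Proof.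
have [u0 v0] := (vnorm2_ge0 u, vnorm2_ge0 v).
apply: vnorm2_le; first exact: addr_ge0.
rewrite !mxE [leRHS]sqrrD !vnorm2_sqr.
set a := u 0 0; set b := u 1 0; set c := v 0 0; set d := v 1 0.
(* Cauchy-Schwarz: after squaring, the gap is [(a * d - b * c) ^+ 2] (Lagrange's identity). A
   nonpositive left side is treated apart because it cannot be squared. *)
have h : a * c + b * d <= vnorm2 u * vnorm2 v.
  have [|/ltW h0] := leP (a * c + b * d) 0.
    by move=> /le_trans; apply; exact: mulr_ge0.
  rewrite -(ler_pXn2r (ltn0Sn 1)) ?nnegrE ?mulr_ge0//.
  rewrite [leRHS]exprMn !vnorm2_sqr -/a -/b -/c -/d.
  have := sqr_ge0 (a * d - b * c); nra.
by rewrite -mulr_natl; lra.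
Qed.

Lemma vnorm2_eq0 v : vnorm2 v = 0 -> v = 0.
Proof.
move=> /(congr1 (fun x => x ^+ 2)); rewrite vnorm2_sqr expr0n /=.
have := sqr_ge0 (v 0 0); have := sqr_ge0 (v 1 0) => h1 h0 h.
have /eqP : v 0 0 ^+ 2 = 0 by lra.
have /eqP : v 1 0 ^+ 2 = 0 by lra.
rewrite !sqrf_eq0 => /eqP v1 /eqP v0.
by apply/matrixP => i j; rewrite !ord1 mxE; case: (ord2P i) => ->.
Qed.

Definition frob2 A : R := A 0 0 ^+ 2 + A 0 1 ^+ 2 + A 1 0 ^+ 2 + A 1 1 ^+ 2.

(** Cauchy-Schwarz on each row of [A]; the two squares below are the gaps in Lagrange's identity. *)
Lemma vnorm2_mulmx_frob A v : vnorm2 (A *m v) ^+ 2 <= frob2 A * vnorm2 v ^+ 2.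
Proof.
rewrite !vnorm2_sqr !mul2mxE /frob2.
have := sqr_ge0 (A 0 0 * v 1 0 - A 0 1 * v 0 0).
have := sqr_ge0 (A 1 0 * v 1 0 - A 1 1 * v 0 0).
lra.
Qed.

Let unit_image A := [set vnorm2 (A *m v) | v in [set v : 'cV[R]_2 | vnorm2 v = 1]].

Let unit_image_ub A : ubound (unit_image A) (Num.sqrt (frob2 A)).
Proof.
move=> _ [v /= v1 <-].
have := vnorm2_mulmx_frob A v; rewrite v1 expr1n mulr1 => h.
have f0 : 0 <= frob2 A by rewrite !addr_ge0// sqr_ge0.
by rewrite -(ler_pXn2r (ltn0Sn 1)) ?nnegrE ?vnorm2_ge0 ?sqrtr_ge0// [leRHS]sqr_sqrtr.
Qed.

Let vnorm2_e0 : vnorm2 (delta_mx 0 0 : 'cV[R]_2) = 1.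
Proof. by rewrite /vnorm2 !mxE/= expr1n expr0n/= addr0 sqrtr1. Qed.

Let unit_image_sup A : has_sup (unit_image A).
Proof.
split; last by exists (Num.sqrt (frob2 A)); exact: unit_image_ub.
by exists (vnorm2 (A *m delta_mx 0 0)); exists (delta_mx 0 0).
Qed.

Lemma vnorm2_mulmx A v : vnorm2 (A *m v) <= opnorm2 A * vnorm2 v.
Proof.
have [v0|v0] := eqVneq (vnorm2 v) 0.
  by rewrite (vnorm2_eq0 _ v0) mulmx0 -(scale0r 0) vnorm2Z normr0 mul0r mulr0.
have vp : 0 < vnorm2 v by rewrite lt_neqAle eq_sym v0 vnorm2_ge0.
rewrite -ler_pdivrMr// mulrC -[X in X * _]ger0_norm ?invr_ge0 ?vnorm2_ge0//.
rewrite -vnorm2Z scalemxAr.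
apply: sup_upper_bound; first exact: unit_image_sup.
exists ((vnorm2 v)^-1 *: v) => //=.
by rewrite vnorm2Z ger0_norm ?invr_ge0 ?vnorm2_ge0// mulVf.
Qed.

Lemma opnorm2_le A c : (forall v, vnorm2 (A *m v) <= c * vnorm2 v) -> opnorm2 A <= c.
Proof.
move=> h; apply: ge_sup; first by have [] := unit_image_sup A.
by move=> _ [v /= v1 <-]; rewrite (le_trans (h v))// v1 mulr1.
Qed.

Lemma opnorm2_ge0 A : 0 <= opnorm2 A.
Proof.
have := vnorm2_mulmx A (delta_mx 0 0); rewrite vnorm2_e0 mulr1.
exact/le_trans/vnorm2_ge0.
Qed.

Lemma opnorm2_ge_entry A : `|A 0 0| <= opnorm2 A.
Proof.
have := vnorm2_mulmx A (delta_mx 0 0); rewrite vnorm2_e0 mulr1.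
apply: le_trans; rewrite -sqrtr_sqr ler_sqrt ?addr_ge0 ?sqr_ge0//.
by rewrite !mul2mxE !mxE/= !mulr1 !mulr0 !addr0 lerDl sqr_ge0.
Qed.

Lemma opnorm2M A B : opnorm2 (A *m B) <= opnorm2 A * opnorm2 B.
Proof.
apply: opnorm2_le => v; rewrite -mulmxA (le_trans (vnorm2_mulmx _ _))// -mulrA.
by rewrite ler_wpM2l ?opnorm2_ge0// vnorm2_mulmx.
Qed.

Lemma opnorm2D A B : opnorm2 (A + B) <= opnorm2 A + opnorm2 B.
Proof.
apply: opnorm2_le => v; rewrite mulmxDl (le_trans (vnorm2D _ _))// mulrDl.
by rewrite lerD// vnorm2_mulmx.
Qed.

Lemma opnorm2_1 : opnorm2 (1%:M : 'M[R]_2) <= 1.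
Proof. by apply: opnorm2_le => v; rewrite mul1mx mul1r. Qed.

Lemma opnorm2_le_frob2 A c : 0 <= c -> frob2 A <= c ^+ 2 -> opnorm2 A <= c.
Proof.
move=> c0 h; apply: opnorm2_le => v.
rewrite -(ler_pXn2r (ltn0Sn 1)) ?nnegrE ?mulr_ge0 ?vnorm2_ge0//.
rewrite (le_trans (vnorm2_mulmx_frob _ _))// exprMn ler_wpM2r//.
exact: sqr_ge0.
Qed.

(* The square of the norm is the largest root of the characteristic
   polynomial X^2 - (frob2 A) X + (det A)^2 of the symmetric matrix A^T A. *)
Lemma opnorm2E A : opnorm2 A =
  Num.sqrt ((frob2 A + Num.sqrt (frob2 A ^+ 2 - 4 * (\det A) ^+ 2)) / 2).
Proof.
have := vnorm2_mulmx A; have := opnorm2_le A; have := opnorm2_ge0 A.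
have vsq := vnorm2_sqr; have vge0 := vnorm2_ge0.
rewrite det2E /frob2.
set a := A 0 0; set b := A 0 1; set c := A 1 0; set d := A 1 1.
move=> op0 ople opge.
(* [p], [q], [r] are the entries of the Gram matrix A^T A, with [q] off the diagonal; [l] below is
   its larger eigenvalue. *)
pose p := a ^+ 2 + c ^+ 2; pose q := a * b + c * d; pose r := b ^+ 2 + d ^+ 2.
set F := a ^+ 2 + b ^+ 2 + c ^+ 2 + d ^+ 2.
set D := F ^+ 2 - _.
have D_ge : (p - r) ^+ 2 <= D.
  have -> : D = (p - r) ^+ 2 + (2 * q) ^+ 2 by rewrite /D /F /p /q /r; ring.
  by rewrite lerDl sqr_ge0.
have s2 : Num.sqrt D ^+ 2 = D by rewrite sqr_sqrtr// (le_trans (sqr_ge0 _) D_ge).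
have s_ge : `|p - r| <= Num.sqrt D.
  by rewrite -sqrtr_sqr ler_sqrt// (le_trans (sqr_ge0 _) D_ge).
have s0 := sqrtr_ge0 D.
set s := Num.sqrt D in s2 s_ge s0 *.
set l := (F + s) / 2.
have FE : F = p + r by rewrite /F /p /r; ring.
have DE : D = (p - r) ^+ 2 + 4 * q ^+ 2 by rewrite /D /F /p /q /r; ring.
have p0 : 0 <= p by rewrite addr_ge0 ?sqr_ge0.
have r0 : 0 <= r by rewrite addr_ge0 ?sqr_ge0.
have [lp lr] : p <= l /\ r <= l.
  by move: s_ge; rewrite ler_norml => /andP[h1 h2]; rewrite /l FE; split; lra.
have lq : (l - p) * (l - r) = q ^+ 2 by rewrite /l FE; nra.
have Av v : vnorm2 (A *m v) ^+ 2 =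
    p * v 0 0 ^+ 2 + 2 * q * (v 0 0 * v 1 0) + r * v 1 0 ^+ 2.
  by rewrite vsq !mul2mxE -/a -/b -/c -/d /p /q /r; ring.
have l0 : 0 <= l by lra.
apply/eqP; rewrite eq_le; apply/andP; split.
  apply: ople => v; rewrite -(ler_pXn2r (ltn0Sn 1)) ?nnegrE ?mulr_ge0 ?sqrtr_ge0//.
  rewrite Av exprMn vsq sqr_sqrtr//.
  set x := v 0 0; set y := v 1 0.
  suff h : 0 <= (l - p) * x ^+ 2 - 2 * q * (x * y) + (l - r) * y ^+ 2 by lra.
  (* The quadratic form of l - A^T A is nonnegative: multiply by [l - p] and complete the square.
     When [l = p], the relation [lq] forces [q = 0] and the form is diagonal. *)
  have [lp0|lp0] := eqVneq (l - p) 0.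
    have /eqP : q ^+ 2 = 0 by rewrite -lq lp0 mul0r.
    rewrite sqrf_eq0 => /eqP ->; rewrite lp0.
    have : 0 <= (l - r) * y ^+ 2 by rewrite mulr_ge0 ?sqr_ge0// subr_ge0.
    by lra.
  have lp1 : 0 < l - p by rewrite lt_neqAle eq_sym lp0 subr_ge0.
  rewrite -(pmulr_rge0 _ lp1).
  have -> : (l - p) * ((l - p) * x ^+ 2 - 2 * q * (x * y) + (l - r) * y ^+ 2) =
    ((l - p) * x - q * y) ^+ 2 + ((l - p) * (l - r) - q ^+ 2) * y ^+ 2 by ring.
  by rewrite lq subrr mul0r addr0 sqr_ge0.
rewrite -(ler_pXn2r (ltn0Sn 1)) ?nnegrE ?sqrtr_ge0// [leLHS]sqr_sqrtr//.
(* An eigenvector (x, y) of A^T A for [l] is stretched by exactly the square root of [l], which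
   gives the reverse inequality. *)
have main x y : (l - p) * x = q * y -> (l - r) * y = q * x -> 0 < x ^+ 2 + y ^+ 2 ->
    l <= opnorm2 A ^+ 2.
  move=> e1 e2 xy0.
  have := opge (\col_i if i == 0 then x else y).
  rewrite -(ler_pXn2r (ltn0Sn 1)) ?nnegrE ?mulr_ge0 ?sqrtr_ge0//.
  rewrite exprMn Av vsq !mxE/=.
  have -> : p * x ^+ 2 + 2 * q * (x * y) + r * y ^+ 2 = l * (x ^+ 2 + y ^+ 2).
    have : x * (q * y) = x * ((l - p) * x) by rewrite e1.
    have : y * (q * x) = y * ((l - r) * y) by rewrite e2.
    lra.
  by rewrite ler_pM2r.
(* For a diagonal Gram matrix a coordinate vector is an eigenvector; otherwise [(q, l - p)] is one
   and is nonzero. *)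
have [q0|q0] := eqVneq q 0.
  move: lq; rewrite q0 expr0n/= => /eqP; rewrite mulf_eq0 => /orP[] /eqP h.
    by apply: (main 1 0); rewrite ?h ?q0; lra.
  by apply: (main 0 1); rewrite ?h ?q0; lra.
apply: (main q (l - p)); first by rewrite mulrC.
  by rewrite mulrC lq expr2.
by rewrite ltr_wpDr ?sqr_ge0// lt_neqAle eq_sym sqrf_eq0 q0 sqr_ge0.
Qed.

(** The difference [frob2 A - 2 * \det A] is the sum of the squares of [A 0 0 - A 1 1] and
    [A 0 1 + A 1 0], so [frob2 A] is at least 2 and the closed form is at least 1. *)
Lemma opnorm2_ge1 A : \det A = 1 -> 1 <= opnorm2 A.
Proof.
move=> detA; rewrite opnorm2E -[leLHS]sqrtr1 ler_wsqrtr//.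
have : 2 <= frob2 A.
  have := detA; rewrite det2E /frob2.
  by have := sqr_ge0 (A 0 0 - A 1 1); have := sqr_ge0 (A 0 1 + A 1 0); lra.
by have := sqrtr_ge0 (frob2 A ^+ 2 - 4 * \det A ^+ 2); lra.
Qed.

(** The closed form replaces a supremum over uncountably many unit vectors by sums, products and
    square roots of the entries. *)
Lemma measurable_opnorm2 (d : measure_display) (T : measurableType d)
    (M : T -> 'M[R]_2) :
  (forall i j, measurable_fun [set: T] (fun x => M x i j)) ->
  measurable_fun [set: T] (fun x => opnorm2 (M x)).
Proof.
move=> mM.
have msqrt (g : T -> R) : measurable_fun setT g ->
    measurable_fun setT (fun x => Num.sqrt (g x)).
  move=> mg; apply: measurableT_comp mg.
  by apply: continuous_measurable_fun; exact: sqrt_continuous.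
under eq_fun do rewrite opnorm2E det2E /frob2.
have mF : measurable_fun setT (fun x => M x 0 0 ^+ 2 + M x 0 1 ^+ 2 + M x 1 0 ^+ 2 +
    M x 1 1 ^+ 2).
  have mX i j := measurable_funX 2 (mM i j).
  exact: (measurable_funD (measurable_funD (measurable_funD _ _) _) _).
apply: (msqrt _); apply: measurable_funM => //; apply: measurable_funD => //.
apply: (msqrt _); apply: measurable_funB; first exact: measurable_funX.
apply: measurable_funM => //; apply: measurable_funX.
by apply: measurable_funB; exact: measurable_funM.
Qed.

End OperatorNorm.

(** * Subadditive sequences bounded by Birkhoff sums *)

Section Subadditive.
Context {R : realType} {T : Type}.

(* The window sum W N = \sum_(j < n) a (N + j) telescopes:
   W N.+1 - W N = a (N + n) - a N <= a n \o phi^N. *)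
Lemma subadditive_le_sum (phi : T -> T) (a : nat -> T -> R) (K : R) :
  (forall m n w, a (m + n)%N w <= a m (iter n phi w) + a n w) ->
  (forall n w, 0 <= a n w <= n%:R * K) ->
  forall n m w,
    n%:R * a m w <= 2 * n%:R ^+ 2 * K + \sum_(i < m) a n (iter i phi w).
Proof.
move=> sub bnd n m w.
have K0 : 0 <= K by have /andP[h1 h2] := bnd 1%N w; lra.
have n0 : 0 <= n%:R :> R by exact: ler0n.
have S0 k : 0 <= \sum_(i < k) a n (iter i phi w).
  by apply: sumr_ge0 => i _; have /andP[] := bnd n (iter i phi w).
have leK k : (k <= n)%N -> k%:R * K <= n%:R * K.
  by move=> kn; rewrite ler_wpM2r// ler_nat.
(* For times shorter than the window, the term [2 * n%:R ^+ 2 * K] alone suffices. *)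
have [mn|nm] := ltnP m n.
  have /andP[_ am] := bnd m w.
  have h : n%:R * a m w <= n%:R * (n%:R * K).
    by rewrite ler_wpM2l// (le_trans am)// leK// ltnW.
  have := S0 m; have := mulr_ge0 n0 (mulr_ge0 n0 K0); rewrite expr2; lra.
have cst c : n%:R * c = \sum_(j < n) c by rewrite sumr_const card_ord mulr_natl.
pose W N := \sum_(j < n) a (N + j)%N w.
have WS N : W N.+1 <= W N + a n (iter N phi w).
  have -> : W N.+1 = \sum_(j < n.+1) a (N + j)%N w - a N w.
    rewrite big_ord_recl/= addn0 addrAC subrr add0r.
    by apply: eq_bigr => j _; rewrite addSnnS.
  rewrite big_ord_recr/= -/(W N) -addrA lerD2l lerBlDr addnC; exact: sub.
have WE N : W N <= n%:R * (n%:R * K) + \sum_(i < N) a n (iter i phi w).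
  elim: N => [|N ih].
    rewrite big_ord0 addr0 cst; apply: ler_sum => j _; have /andP[_ aj] := bnd j w.
    by rewrite (le_trans aj)// leK// ltnW.
  by rewrite big_ord_recr/= (le_trans (WS N))// addrA lerD2r.
have -> : m = ((m - n) + n)%N by rewrite subnK.
set N := (m - n)%N.
(* Write the left side as [n] equal copies and split the [j]-th at time [N + j]; the remaining
   [n - j] iterates cost at most [n%:R * K]. *)
have step : n%:R * a (N + n)%N w <= W N + n%:R * (n%:R * K).
  rewrite [leLHS]cst [X in _ + X]cst -big_split/=; apply: ler_sum => j _.
  have -> : (N + n = (n - j) + (N + j))%N by have := ltn_ord j; lia.
  have /andP[_ h] := bnd (n - j)%N (iter (N + j) phi w).
  rewrite (le_trans (sub _ _ _))// [leRHS]addrC lerD2r (le_trans h)//.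
  by rewrite leK// leq_subr.
have : \sum_(i < N) a n (iter i phi w) <= \sum_(i < N + n) a n (iter i phi w).
  rewrite big_split_ord/= lerDl; apply: sumr_ge0 => i _.
  by have /andP[] := bnd n (iter (N + i) phi w).
have := WE N; rewrite expr2; lra.
Qed.

End Subadditive.

(** * Transfer matrices: bounds, growth and dependence on the energy *)

Section TransferMatrix.
Context {R : realType} {T : Type} (phi : T -> T) (f : T -> R).
Implicit Types (a E K : R) (w : T).

Lemma det_transfer N w E : \det (transfer phi f N w E) = 1.
Proof.
elim: N => [|N ih] /=; first exact: det1.
by rewrite det_mulmx ih mulr1 det2E !mxE/=; ring.
Qed.

Lemma transferD m n w E :
  transfer phi f (m + n) w E = transfer phi f m (iter n phi w) E *m transfer phi f n w E.
Proof.
elim: m => [|m ih]; first by rewrite mul1mx.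
by rewrite addSn /= ih mulmxA /potential -addSn iterD.
Qed.

Context (M : R) (M0 : 0 <= M) (fM : forall w, `|f w| <= M).

Lemma opnorm2_transfer_step a E : opnorm2 (transfer_step a E) <= `|a - E| + 2.
Proof.
apply: opnorm2_le_frob2; first by rewrite addr_ge0.
rewrite /frob2 !mxE/= [leRHS]sqrrD real_normK ?num_real//.
by have := normr_ge0 (a - E); lra.
Qed.

Lemma opnorm2_transfer_stepB a E E' :
  opnorm2 (transfer_step a E - transfer_step a E') <= `|E - E'|.
Proof.
apply: opnorm2_le_frob2 => //; rewrite /frob2 !mxE/= real_normK ?num_real//; lra.
Qed.

Lemma transfer_bound K E N w : `|E| <= K ->
  opnorm2 (transfer phi f N w E) <= (M + K + 2) ^+ N.
Proof.
move=> EK; elim: N => [|N ih] /=; first by rewrite expr0 opnorm2_1.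
rewrite (le_trans (opnorm2M _ _))// exprS ler_pM ?opnorm2_ge0//.
rewrite (le_trans (opnorm2_transfer_step _ _))// lerD2r.
by rewrite (le_trans (ler_normB _ _))// lerD//; exact: fM.
Qed.

(** Induction that changes the energy in one factor at a time. The constant grows exponentially in
    [N], which is harmless since it is used at one fixed [N]; what matters is its uniformity in
    [w]. *)
Lemma transfer_lipschitz K E E' N w : `|E| <= K -> `|E'| <= K ->
  opnorm2 (transfer phi f N w E - transfer phi f N w E') <=
    N%:R * (M + K + 2) ^+ N * `|E - E'|.
Proof.
move=> EK EK'; have K0 : 0 <= K by exact: le_trans EK.
elim: N => [|N ih] /=.
  by rewrite subrr !mul0r; apply: opnorm2_le_frob2 => //; rewrite /frob2 !mxE; lra.
set a := potential _ _ _ _; set A := transfer _ _ _ _ E in ih *.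
set B := transfer _ _ _ _ E' in ih *.
have -> : transfer_step a E *m A - transfer_step a E' *m B =
  transfer_step a E *m (A - B) + (transfer_step a E - transfer_step a E') *m B.
  by rewrite mulmxBr mulmxBl addrA subrK.
have L1 : 1 <= M + K + 2 by have := M0; lra.
set L := M + K + 2 in ih L1 *.
have sE : opnorm2 (transfer_step a E) <= L.
  rewrite (le_trans (opnorm2_transfer_step _ _))// lerD2r.
  by rewrite (le_trans (ler_normB _ _))// lerD//; exact: fM.
have BL : opnorm2 B <= L ^+ N by exact: transfer_bound.
have LN : 0 <= L ^+ N by rewrite exprn_ge0//; lra.
have h1 : opnorm2 (transfer_step a E *m (A - B)) <= L * (N%:R * L ^+ N * `|E - E'|).
  by rewrite (le_trans (opnorm2M _ _))// ler_pM ?opnorm2_ge0.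
have h2 : opnorm2 ((transfer_step a E - transfer_step a E') *m B) <= `|E - E'| * L ^+ N.
  by rewrite (le_trans (opnorm2M _ _))// ler_pM ?opnorm2_ge0// opnorm2_transfer_stepB.
have h3 : `|E - E'| * L ^+ N <= L * (`|E - E'| * L ^+ N).
  by rewrite ler_peMl// mulr_ge0.
rewrite (le_trans (opnorm2D _ _))// exprS -natr1; lra.
Qed.

Lemma transfer_growth E N w : M + 2 <= `|E| ->
  (`|E| - M - 1) ^+ N <= opnorm2 (transfer phi f N w E).
Proof.
move=> ME; apply: le_trans (opnorm2_ge_entry _).
(* The induction also carries a cone condition: the first column keeps its top entry dominant, so
   each step multiplies that entry by at least [|E| - M - 1], which is at least 1. *)
suff [] : (`|E| - M - 1) ^+ N <= `|transfer phi f N w E 0 0| /\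
  `|transfer phi f N w E 1 0| <= `|transfer phi f N w E 0 0| by [].
elim: N => [|N [ih1 ih2]]; first by rewrite !mxE/= normr1 normr0 expr0.
rewrite /= !mul2mxE !mxE/= mul1r mul0r addr0 mulN1r.
set a := potential _ _ _ _.
have aM : `|a| <= M by exact: fM.
set x := transfer _ _ _ _ _ 0 0 in ih1 ih2 *.
set y := transfer _ _ _ _ _ 1 0 in ih2 *.
have aE : `|E| - M <= `|a - E|.
  by have := lerB_dist E a; rewrite distrC; lra.
have h : (`|E| - M - 1) * `|x| <= `|(a - E) * x - y|.
  have := lerB_dist ((a - E) * x) y; rewrite normrM.
  have : (`|E| - M) * `|x| <= `|a - E| * `|x| by rewrite ler_wpM2r.
  lra.
split; last by rewrite (le_trans _ h)// ler_peMl//; lra.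
by rewrite exprS (le_trans _ h)// ler_wpM2l//; lra.
Qed.

Definition log_transfer E N w : R := ln (opnorm2 (transfer phi f N w E)).

Lemma opnorm2_transfer_ge1 E N w : 1 <= opnorm2 (transfer phi f N w E).
Proof. by rewrite opnorm2_ge1// det_transfer. Qed.

Lemma opnorm2_transfer_gt0 E N w : 0 < opnorm2 (transfer phi f N w E).
Proof. exact: lt_le_trans (opnorm2_transfer_ge1 _ _ _). Qed.

Lemma log_transfer_ge0 E N w : 0 <= log_transfer E N w.
Proof. by rewrite ln_ge0// opnorm2_transfer_ge1. Qed.

Lemma log_transfer_subadditive E m n w :
  log_transfer E (m + n)%N w <= log_transfer E m (iter n phi w) + log_transfer E n w.
Proof.
rewrite /log_transfer -lnM ?posrE ?opnorm2_transfer_gt0//.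
by rewrite ler_ln ?posrE ?mulr_gt0 ?opnorm2_transfer_gt0// transferD opnorm2M.
Qed.

Lemma log_transfer_le K E N w : `|E| <= K -> log_transfer E N w <= N%:R * ln (M + K + 2).
Proof.
move=> EK; have L0 : 0 < M + K + 2 by have := M0; have := le_trans (normr_ge0 E) EK; lra.
rewrite mulr_natl -lnXn// ler_ln ?posrE ?exprn_gt0 ?opnorm2_transfer_gt0//.
exact: transfer_bound.
Qed.

(** Since the norms are at least 1, where the logarithm is 1-Lipschitz by [ln (1 + t) <= t], the
    Lipschitz bound for the matrices passes to the logarithms. *)
Lemma log_transfer_lipschitz K E E' N w : `|E| <= K -> `|E'| <= K ->
  log_transfer E N w <= log_transfer E' N w + N%:R * (M + K + 2) ^+ N * `|E - E'|.
Proof.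
move=> EK EK'; apply: le_trans (lerD (lexx _) (transfer_lipschitz K E E' N w EK EK')).
rewrite /log_transfer.
have := opnorm2D (transfer phi f N w E - transfer phi f N w E') (transfer phi f N w E').
rewrite subrK.
have := opnorm2_transfer_ge1 E N w; have := opnorm2_transfer_ge1 E' N w.
set x := opnorm2 _; set y := opnorm2 _; set z := opnorm2 _ => x1 y1 yxz.
have x0 : 0 < x by lra.
have y0 : 0 < y by lra.
have z0 : 0 <= z by exact: opnorm2_ge0.
rewrite -lerBlDl -ln_div ?posrE//.
have -> : y / x = 1 + (y - x) / x by rewrite mulrBl divff ?gt_eqF// addrC subrK.
apply: (@le_trans _ _ ((y - x) / x)).
  by apply: le_ln1Dx; rewrite ltr_pdivlMr//; lra.
rewrite ler_pdivrMr// (@le_trans _ _ z)//; first by lra.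
by rewrite ler_peMr.
Qed.

End TransferMatrix.

(** * The upper half of the ergodic theorem *)

Section Birkhoff.
Context {R : realType} {d : measure_display} {Omega : measurableType d}.
Variables (P : probability Omega R) (phi : Omega -> Omega).
Hypotheses (phi_meas : measurable_fun [set: Omega] phi)
  (phi_pres : forall A : set Omega, measurable A -> P (phi @^-1` A) = P A)
  (phi_ergodic : forall A : set Omega, measurable A -> phi @^-1` A = A ->
                   P A = 0%E \/ P A = 1%E).

Lemma bounded_integrable (g : Omega -> R) (K : R) :
  measurable_fun [set: Omega] g -> (forall w, `|g w| <= K) ->
  P.-integrable [set: Omega] (EFin \o g).
Proof.
move=> mg gK; apply: measurable_bounded_integrable => //.
  by rewrite (le_lt_trans (probability_le1 _ _))// ltry.
exists K; split; first exact: num_real.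
by move=> x Kx w _; exact: le_trans (gK w) (ltW Kx).
Qed.

Lemma integral_preserving (g : Omega -> R) :
  measurable_fun [set: Omega] g -> (forall w, 0 <= g w) ->
  (\int[P]_w (g (phi w))%:E = \int[P]_w (g w)%:E)%E.
Proof.
move=> mg g0; transitivity (\int[pushforward P phi]_w (g w)%:E)%E.
  rewrite (@ge0_integral_pushforward _ _ _ _ _ _ phi_meas P setT (EFin \o g))//.
    exact: measurableT_comp.
  by move=> w _; rewrite lee_fin.
by apply: eq_measure_integral => A mA _; exact: phi_pres.
Qed.

(** The maximum of the Birkhoff sums of lengths 0 to [n], in the recursive form that relates [w] to
    [phi w]. *)
Fixpoint max_sum (g : Omega -> R) n w : R :=
  if n is n'.+1 then Num.max 0 (g w + max_sum g n' (phi w)) else 0.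

Lemma max_sum_ge0 g n w : 0 <= max_sum g n w.
Proof. by case: n => [|n] //=; rewrite le_max lexx. Qed.

Lemma max_sum_nd g m n w : (m <= n)%N -> max_sum g m w <= max_sum g n w.
Proof.
elim: n m w => [|n ih] [|m] w //=; first by rewrite le_max lexx.
by move=> mn; rewrite ge_max le_max lexx/= le_max lerD2l ih ?orbT.
Qed.

Lemma sum_le_max_sum g n w : \sum_(i < n) g (iter i phi w) <= max_sum g n w.
Proof.
elim: n w => [|n ih] w; first by rewrite big_ord0.
rewrite big_ord_recl /= le_max; apply/orP; right; rewrite lerD2l.
by apply: le_trans (ih (phi w)); apply: ler_sum => i _; rewrite -iterSr.
Qed.

Lemma max_sum_le g K n w : (forall w, `|g w| <= K) -> max_sum g n w <= n%:R * K.
Proof.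
move=> gK; have K0 : 0 <= K := le_trans (normr_ge0 _) (gK w).
elim: n w => [|n ih] w /=; first by rewrite mul0r.
rewrite ge_max mulr_ge0//= -natr1 mulrDl mul1r addrC lerD//.
by rewrite (le_trans (ler_norm _)).
Qed.

Lemma measurable_max_sum g n : measurable_fun [set: Omega] g ->
  measurable_fun [set: Omega] (max_sum g n).
Proof.
move=> mg; elim: n => [|n ih] //=.
apply: measurable_maxr => //; apply: measurable_funD => //.
exact: measurableT_comp ih phi_meas.
Qed.

(* Garsia's argument: with M n := max_sum g n, the increment
   M n.+1 - M n \o phi = max g (- M n \o phi) has nonnegative integral, and it
   converges to g wherever M n is unbounded. *)
Lemma ergodic_sums_bounded (g : Omega -> R) (K : R) :
  measurable_fun [set: Omega] g -> (forall w, `|g w| <= K) ->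
  (\int[P]_w (g w)%:E < 0)%E ->
  {ae P, forall w, exists C : R, forall n, \sum_(i < n) g (iter i phi w) <= C}.
Proof.
move=> mg gK g_neg.
(* [B] is the set where the maximal sums stay bounded; natural bounds [k] keep it a countable
   combination of measurable sets. *)
pose B := \bigcup_k \bigcap_n [set w | max_sum g n w <= k%:R].
have BP w : B w <-> exists C : R, forall n, max_sum g n w <= C.
  split=> [[k _ h]|[C h]]; first by exists k%:R => n; exact: h.
  exists (Num.trunc C).+1 => // n _ /=.
  by rewrite (le_trans (h n))// ltW// truncnS_gt.
have mB : measurable B.
  apply: bigcup_measurable => k _; apply: bigcapT_measurable => n.
  have -> : [set w | max_sum g n w <= k%:R] = [set: Omega] `&` max_sum g n @^-1` `]-oo, k%:R].
    by rewrite setTI; apply/seteqP; split => w /=; rewrite in_itv.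
  exact: measurable_max_sum.
have invB : phi @^-1` B = B.
  apply/seteqP; split => w /= /BP[C h]; apply/BP.
    exists (Num.max 0 (g w + C)) => -[|n] /=; first by rewrite le_max lexx.
    by rewrite ge_max le_max lexx/= le_max lerD2l h orbT.
  exists (C - g w) => n; rewrite lerBrDl.
  by apply: le_trans (h n.+1); rewrite /= le_max lexx orbT.
(* [B] is invariant, so it has measure 1, which is the claim, or measure 0, which is refuted
   below. *)
have [PB0|PB1] := phi_ergodic _ mB invB; last first.
  exists (~` B); split.
  - exact: measurableC.
  - by rewrite probability_setC// PB1 subee.
  - move=> w /= nw /BP[C h]; apply: nw; exists C => n.
    exact: le_trans (sum_le_max_sum g n w) (h n).
exfalso.
pose D n w := max_sum g n.+1 w - max_sum g n (phi w).
have DE n w : D n w = Num.max (- max_sum g n (phi w)) (g w).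
  by rewrite /D /= addr_maxl add0r addrK.
have mD n : measurable_fun setT (D n).
  apply: measurable_funB; first exact: measurable_max_sum.
  exact: measurableT_comp (measurable_max_sum g n mg) phi_meas.
have DK n w : `|D n w| <= K.
  have /andP[h1 h2] : - K <= g w <= K by rewrite -ler_norml.
  have K0 : 0 <= K := le_trans (normr_ge0 _) (gK w).
  rewrite DE ler_norml le_max h1 orbT/= ge_max h2 andbT.
  by have := max_sum_ge0 g n (phi w); lra.
have intM n : P.-integrable setT (EFin \o max_sum g n).
  apply: (@bounded_integrable _ (n%:R * K)); first exact: measurable_max_sum.
  by move=> w; rewrite ger0_norm ?max_sum_ge0// max_sum_le.
have intMphi n : P.-integrable setT (EFin \o (max_sum g n \o phi)).
  apply: (@bounded_integrable _ (n%:R * K)).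
    exact: measurableT_comp (measurable_max_sum g n mg) phi_meas.
  by move=> w /=; rewrite ger0_norm ?max_sum_ge0// max_sum_le.
(* By invariance of [P], composition with [phi] drops out, leaving the integral of [max_sum g n.+1]
   minus that of [max_sum g n]. *)
have intD n : (0 <= \int[P]_w (D n w)%:E)%E.
  under eq_integral do rewrite EFinB.
  rewrite (@integralB_EFin _ _ _ _ setT _ (max_sum g n \o phi) measurableT)//.
  rewrite [X in (_ - X)%E]integral_preserving; last 2 first.
    exact: measurable_max_sum.
    by move=> w; exact: max_sum_ge0.
  rewrite sube_ge0; last by rewrite (integrable_fin_num measurableT (intM n)).
  apply: ge0_le_integral => //.
  - by move=> w _; rewrite lee_fin max_sum_ge0.
  - by apply/measurable_EFinP; exact: measurable_max_sum.
  - by apply/measurable_EFinP; exact: measurable_max_sum.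
  - by move=> w _; rewrite lee_fin max_sum_nd.
have [] := @dominated_convergence _ _ _ P setT measurableT
    (fun n => EFin \o D n) (EFin \o g) (fun=> K%:E).
- by move=> n; apply/measurable_EFinP.
- exact/measurable_EFinP.
- exists B; split => // w /= nBw; apply/BP; apply: contrapT => nC.
  apply: nBw => _; apply: cvg_near_cst.
  (* Off [B] the maximal sums are unbounded at [w], hence at [phi w]. Once they exceed [K], the
     maximum in [DE] equals [g w], so the sequence is eventually constant. *)
  have [n Kn] : exists n, K < max_sum g n (phi w).
    apply: contrapT => /forallNP h; apply: nC; exists (Num.max 0 (g w + K)) => -[|n] /=.
      by rewrite le_max lexx.
    rewrite ge_max le_max lexx/= le_max lerD2l; apply/orP; right.
    by rewrite leNgt; apply/negP; exact: h.
  near=> m; congr EFin; rewrite DE; apply/max_idPr.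
  have nm : (n <= m)%N by near: m; exact: nbhs_infty_ge.
  have /andP[h1 h2] : - K <= g w <= K by rewrite -ler_norml.
  have := max_sum_nd g n m (phi w) nm; lra.
- exact: finite_measure_integrable_cst.
- by apply: aeW => w n _; rewrite lee_fin.
move=> _ _ lim.
have : (0 <= \int[P]_w (g w)%:E)%E 
  by apply: (cvge_ge _ lim); apply: nearW => n; exact: intD.
by rewrite leNgt g_neg.
Unshelve. all: by end_near. Qed.

(** The function [h - c] has negative mean, so its Birkhoff sums are almost surely bounded above. *)
Lemma birkhoff_sum_le (h : Omega -> R) (K c : R) :
  measurable_fun [set: Omega] h -> (forall w, `|h w| <= K) ->
  (\int[P]_w (h w)%:E < c%:E)%E ->
  {ae P, forall w, exists C : R, forall n, \sum_(i < n) h (iter i phi w) <= C + n%:R * c}.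
Proof.
move=> mh hK hc.
have mg : measurable_fun setT (fun w => h w - c) by exact: measurable_funB.
have gK w : `|h w - c| <= K + `|c| by rewrite (le_trans (ler_normB _ _))// lerD.
have : (\int[P]_w (h w - c)%:E < 0)%E.
  under eq_integral do rewrite EFinB.
  rewrite (@integralB_EFin _ _ _ _ setT h (fun=> c) measurableT).
  - rewrite integral_cst//.
    rewrite [X in (_ * X)%E](_ : _ = 1%E); last exact: probability_setT.
    by rewrite mule1; rewrite sube_lt0 ?orbT.
  - exact: bounded_integrable hK.
  - exact: finite_measure_integrable_cst.
move/(ergodic_sums_bounded _ _ mg gK).
apply: filterS => w [C hC]; exists C => n; have := hC n.
by rewrite sumrB sumr_const card_ord lerBlDr mulr_natl.
Qed.

End Birkhoff.

(** The constant [C] may depend on [e], because the error [C / m%:R] vanishes as [m] grows. *)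
Lemma limn_esup_le {R : realType} (u : nat -> R) (l : R) :
  (forall e : R, 0 < e -> exists C : R, forall m, (0 < m)%N -> u m <= l + e + C / m%:R) ->
  (limn_esup (fun m => (u m)%:E) <= l%:E)%E.
Proof.
move=> ul; apply/lee_addgt0Pr => e e0.
have e2 : 0 < e / 2 by rewrite divr_gt0.
have [C hC] := ul _ e2.
(* From this index on, [C / m%:R <= e / 2]; the successor also makes [m] positive. *)
pose N := (Num.trunc (C / (e / 2))).+1.
apply: (@le_trans _ _ (ereal_sup ((fun m => (u m)%:E) @` [set m | (N <= m)%N]))).
  by apply: ereal_inf_lbound; exists [set m | (N <= m)%N] => //; exact: nbhs_infty_ge.
apply: ge_ereal_sup => _ [m /= Nm <-]; rewrite -EFinD lee_fin.
have m0 : (0 < m)%N by exact: leq_trans Nm.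
have mR : 0 < m%:R :> R by rewrite ltr0n.
suff : C / m%:R <= e / 2 by have := hC m m0; lra.
rewrite ler_pdivrMr// mulrC -ler_pdivrMr// ltW//.
by rewrite (lt_le_trans (truncnS_gt _))// ler_nat.
Qed.

(** * Minimum of the Lyapunov exponent and two-sided bounds on the integral over energies *)

Section LyapunovExponent.
Context {R : realType} {d : measure_display} {Omega : measurableType d}.
Variables (P : probability Omega R) (phi : Omega -> Omega) (f : Omega -> R).
Hypotheses (phi_meas : measurable_fun [set: Omega] phi)
  (f_meas : measurable_fun [set: Omega] f).
Variables (M : R) (M0 : 0 <= M) (fM : forall w, `|f w| <= M).

Local Notation T := (transfer phi f).

Lemma measurable_log_transfer E N :
  measurable_fun [set: Omega] (log_transfer phi f E N).
Proof.
apply: measurableT_comp; first exact: measurable_ln.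
apply: measurable_opnorm2; elim: N => [|N ih] i j; first exact: measurable_cst.
have miter k : measurable_fun setT (fun w => iter k phi w).
  by elim: k => [|k ihk] //=; exact: measurableT_comp ihk.
under eq_fun do rewrite /= mul2mxE !mxE/=.
have mf : measurable_fun setT (fun w => potential phi f w N.+1).
  exact: measurableT_comp f_meas (miter N.+1).
apply: measurable_funD; apply: measurable_funM => //.
by case: (ord2P i) => ->; rewrite /=; [exact: measurable_funB|exact: measurable_cst].
Qed.

Lemma measurable_opnorm2_transfer N w :
  measurable_fun [set: R] (fun E => opnorm2 (T N w E)).
Proof.
apply: measurable_opnorm2; elim: N => [|N ih] i j; first exact: measurable_cst.
under eq_fun do rewrite /= mul2mxE !mxE/=.
apply: measurable_funD; apply: measurable_funM => //.
by case: (ord2P i) => ->; rewrite /=; [exact: measurable_funB|exact: measurable_cst].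
Qed.

Lemma normr_log_transfer_le E N w :
  `|log_transfer phi f E N w| <= N%:R * ln (M + `|E| + 2).
Proof. by rewrite ger0_norm ?log_transfer_ge0// log_transfer_le. Qed.

Lemma integral_log_transfer_fin_num E N :
  (\int[P]_w (log_transfer phi f E N w)%:E)%E \is a fin_num.
Proof.
apply: integrable_fin_num => //; apply: bounded_integrable; last first.
  exact: normr_log_transfer_le.
exact: measurable_log_transfer.
Qed.

Lemma integral_log_transfer_ge E N c : 0 <= c -> (forall w, c <= log_transfer phi f E N w) ->
  c <= fine (\int[P]_w (log_transfer phi f E N w)%:E).
Proof.
move=> c0 hc; rewrite -lee_fin fineK ?integral_log_transfer_fin_num//.
have -> : c%:E = (\int[P]_w c%:E)%E.
  rewrite integral_cst// [X in (_ * X)%E](_ : _ = 1%E) ?mule1//.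
  exact: probability_setT.
apply: ge0_le_integral => //.
- by apply/measurable_EFinP; exact: measurable_log_transfer.
- by move=> w _; rewrite lee_fin.
Qed.

(** The growth bound is uniform in [w] and [N], so it survives integration and the infimum; it makes
    the exponent coercive. *)
Lemma lyapunov_growth E : M + 2 <= `|E| -> ln (`|E| - M - 1) <= lyapunov P phi f E.
Proof.
move=> ME; apply: lb_le_inf.
  by exists (1%:R^-1 * fine (\int[P]_w (ln (opnorm2 (T 1 w E)))%:E)); exists 0%N.
move=> _ [N _ <-]; rewrite ler_pdivlMl ?ltr0n//.
have l0 : 0 <= ln (`|E| - M - 1) by rewrite ln_ge0//; lra.
apply: integral_log_transfer_ge; first by rewrite mulr_ge0.
move=> w; rewrite mulr_natl -lnXn ?ler_ln ?posrE ?exprn_gt0 ?opnorm2_transfer_gt0//.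
- exact: transfer_growth.
- lra.
- lra.
Qed.

Lemma lyapunov_min : continuous (lyapunov P phi f) ->
  exists E0, forall E, lyapunov P phi f E0 <= lyapunov P phi f E.
Proof.
(* With this [K], [lyapunov_growth] puts the exponent outside [[- K, K]] above its value at 0, a
   point of the interval; a minimum on the interval is therefore global. *)
move=> Lc; pose K := expR (lyapunov P phi f 0) + M + 2.
have e0 := expR_gt0 (lyapunov P phi f 0).
have K0 : 0 <= K by rewrite /K; have := M0; lra.
have [E0 _ hE0] : exists2 c, c \in `[- K, K] &
    forall t, t \in `[- K, K] -> lyapunov P phi f c <= lyapunov P phi f t.
  apply: EVT_min; first lra.
  exact: continuous_subspaceT.
exists E0 => E; have [EK|/ltW KE] := lerP `|E| K.
  by apply: hE0; rewrite in_itv/= -ler_norml.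
apply: (@le_trans _ _ (lyapunov P phi f 0)).
  by apply: hE0; rewrite in_itv/=; apply/andP; split; lra.
apply: le_trans (lyapunov_growth _ _); last by move: KE; rewrite /K; lra.
rewrite -[leLHS]expRK ler_ln ?posrE//; move: KE; rewrite /K; lra.
Qed.

Lemma lyapunov_approx E e : 0 < e -> exists N : nat,
  (\int[P]_w (log_transfer phi f E N.+1 w)%:E <
    (N.+1%:R * (lyapunov P phi f E + e))%:E)%E.
Proof.
move=> e0; pose S := [set N.+1%:R^-1 * fine (\int[P]_w (log_transfer phi f E N.+1 w)%:E)
  | N in [set: nat]].
(* Nonnegativity of the logarithms bounds [S] below, so that [inf] is a genuine infimum and can be
   approached. *)
have infS : has_inf S.
  split; first by exists (1%:R^-1 * fine (\int[P]_w (log_transfer phi f E 1 w)%:E)); exists 0%N.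
  exists 0 => _ [N _ <-]; rewrite mulr_ge0//.
  by apply: integral_log_transfer_ge => // w; exact: log_transfer_ge0.
have [_ [N _ <-] h] := inf_adherent e0 infS.
exists N; rewrite -[ltLHS]fineK ?integral_log_transfer_fin_num// lte_fin.
by rewrite -ltr_pdivrMl ?ltr0n.
Qed.

Lemma opnorm2_transferVE E N w :
  (opnorm2 (T N w E)) ^- 2 = expR (- (2 * log_transfer phi f E N w)).
Proof.
by rewrite expRN expRM_natl lnK// posrE opnorm2_transfer_gt0.
Qed.

Lemma measurable_opnorm2_transferV N w :
  measurable_fun [set: R] (fun E => (opnorm2 (T N w E)) ^- 2).
Proof.
under eq_fun do rewrite opnorm2_transferVE.
apply: measurableT_comp; first exact: measurable_expR.
apply: measurable_funN; apply: measurable_funM => //.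
exact: measurableT_comp (@measurable_ln R) (measurable_opnorm2_transfer N w).
Qed.

(** The integrand is dominated by the Cauchy profile c / (1 + E^2), whose integral is c pi. Having
    [1 <= C] ensures [0 <= ln C] later. *)
Lemma Ical_le : exists2 C : R, 1 <= C &
  forall N w, (0 < N)%N -> (Ical phi f N w <= C%:E)%E.
Proof.
(* For [|E| <= 2 * (M + 2)] the norm is at least 1 and [c] dominates 1 + E^2. Beyond, the norm is at
   least [|E| / 2] as well as 1, so 1 + E^2 is at most 5 times its square. *)
pose c := 9 + 4 * (M + 2) ^+ 2.
have c9 : 9 <= c by rewrite /c lerDl mulr_ge0// sqr_ge0.
have pi2 := @pi_ge2 R.
exists (c * pi).
  by rewrite -[leLHS]mulr1 ler_pM//; lra.
move=> N w N0.
have bound E : (opnorm2 (T N w E)) ^- 2 <= c * (oneDsqr E)^-1.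
  have t1 := opnorm2_transfer_ge1 phi f E N w.
  have o0 : 0 < oneDsqr E by rewrite (lt_le_trans ltr01)// oneDsqr_ge1.
  rewrite ler_pdivlMr// mulrC ler_pdivrMr ?exprn_gt0//; last by lra.
  have EE : E ^+ 2 = `|E| ^+ 2 by rewrite real_normK ?num_real.
  have [h|h] := lerP `|E| (2 * (M + 2)).
    have h2 : `|E| ^+ 2 <= (2 * (M + 2)) ^+ 2.
      by rewrite ler_pXn2r ?nnegrE//; have := M0; lra.
    have h3 : 1 <= opnorm2 (T N w E) ^+ 2 by rewrite exprn_ege1.
    rewrite -[leLHS]mulr1 ler_pM ?(ltW o0)//.
    by rewrite /oneDsqr EE /c; move: h2; rewrite exprMn; lra.
  have ME : M + 2 <= `|E| by have := M0; lra.
  have := transfer_growth phi f M fM E N w ME.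
  have r1 : 1 <= `|E| - M - 1 by lra.
  have : (`|E| - M - 1) <= (`|E| - M - 1) ^+ N by rewrite -[leLHS]expr1 ler_weXn2l.
  move=> /le_trans/[apply] rT.
  have h2 : (`|E| / 2) ^+ 2 <= opnorm2 (T N w E) ^+ 2.
    rewrite ler_pXn2r ?nnegrE ?divr_ge0//; [lra|].
    by apply: le_trans rT; have := M0; lra.
  have h3 : 1 <= opnorm2 (T N w E) ^+ 2 by rewrite exprn_ege1.
  have h4 : 9 * opnorm2 (T N w E) ^+ 2 <= c * opnorm2 (T N w E) ^+ 2.
    by rewrite ler_wpM2r// sqr_ge0.
  by rewrite /oneDsqr EE; move: h2; rewrite exprMn exprVn; lra.
have mV : measurable_fun setT (fun E : R => (oneDsqr E)^-1).
  by apply: continuous_measurable_fun; exact: continuous_oneDsqrV.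
have mI : measurable_fun setT (fun E => c * (oneDsqr E)^-1) by exact: measurable_funM.
have V0 (E : R) : 0 <= (oneDsqr E)^-1.
  by rewrite invr_ge0 (le_trans ler01)// oneDsqr_ge1.
apply: (@le_trans _ _ (\int[lebesgue_measure]_E (c * (oneDsqr E)^-1)%:E)%E).
  apply: ge0_le_integral => //.
  - by move=> E _; rewrite lee_fin invr_ge0 sqr_ge0.
  - by apply/measurable_EFinP; exact: measurable_opnorm2_transferV.
  - exact/measurable_EFinP.
  - by move=> E _; rewrite lee_fin.
rewrite (_ : (\int[_]_E _)%E = (c%:E * \int[lebesgue_measure]_E ((oneDsqr E)^-1)%:E)%E); last first.
  under eq_integral do rewrite EFinM.
  rewrite ge0_integralZl//.
  - exact/measurable_EFinP.
  - by rewrite lee_fin; lra.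
(* By evenness the integral is twice the one over the half-line, which is pi / 2. *)
rewrite (@ge0_symfun_integralT R (fun E => (oneDsqr E)^-1))//.
- rewrite (_ : [set x | (0 <= x)%R] = `[0%R, +oo[%classic); last first.
    by apply/seteqP; split => x /=; rewrite in_itv/= andbT.
  rewrite integral0y_oneDsqr -!EFinM lee_fin; lra.
- exact: continuous_oneDsqrV.
- by move=> E /=; rewrite /oneDsqr sqrrN.
Qed.

(** Restrict the nonnegative integrand to the interval of length [2 * e] around [E0], where it is at
    least exp(-2B). *)
Lemma Ical_ge E0 (e B : R) N w : 0 < e ->
  (forall E, `|E - E0| <= e -> log_transfer phi f E N w <= B) ->
  ((2 * e * expR (- (2 * B)))%:E <= Ical phi f N w)%E.
Proof.
move=> e0 hB.
have itvE : @lebesgue_measure R `[(E0 - e)%R, (E0 + e)%R]%classic = (2 * e)%:E.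
  rewrite lebesgue_measure_itv/= lte_fin ifT; last by lra.
  by rewrite -EFinB; congr _%:E; lra.
have -> : ((2 * e * expR (- (2 * B)))%:E =
    \int[lebesgue_measure]_(E in `[(E0 - e)%R, (E0 + e)%R]) (expR (- (2 * B)))%:E)%E.
  rewrite integral_cst; last exact: measurable_itv.
  by rewrite EFinM muleC; congr (_ * _)%E.
have mI := measurable_opnorm2_transferV N w.
apply: (@le_trans _ _ (\int[lebesgue_measure]_(E in `[(E0 - e)%R, (E0 + e)%R])
    ((opnorm2 (T N w E)) ^- 2)%:E)%E).
  apply: ge0_le_integral => //.
  - by apply/measurable_EFinP; exact: measurable_funTS.
  - move=> E /=; rewrite in_itv/= => /andP[E1 E2]; rewrite lee_fin.
    have Ee : `|E - E0| <= e by rewrite ler_norml; apply/andP; split; lra.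
    by rewrite opnorm2_transferVE ler_expR lerN2 ler_pM2l ?hB.
apply: ge0_subset_integral => //; first exact/measurable_EFinP.
by move=> E _; rewrite lee_fin invr_ge0 sqr_ge0.
Qed.

End LyapunovExponent.

(** * Almost sure bounds on the decay rate *)

Section DecayRate.
Context {R : realType} {d : measure_display} {Omega : measurableType d}.
Variables (P : probability Omega R) (phi : Omega -> Omega) (f : Omega -> R).
Hypotheses (phi_meas : measurable_fun [set: Omega] phi)
  (phi_pres : forall A : set Omega, measurable A -> P (phi @^-1` A) = P A)
  (phi_ergodic : forall A : set Omega, measurable A -> phi @^-1` A = A ->
                   P A = 0%E \/ P A = 1%E)
  (f_meas : measurable_fun [set: Omega] f).
Variables (M : R) (M0 : 0 <= M) (fM : forall w, `|f w| <= M).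

(** The ergodic bound is applied at the single energy [E0], so one null set serves all [E] within
    [r]; the radius [r] is fixed before [w]. *)
Lemma log_transfer_near_le E0 e : 0 < e -> exists2 r : R, 0 < r &
  {ae P, forall w, exists C : R, forall E N, `|E - E0| <= r ->
    log_transfer phi f E N w <= C + N%:R * (lyapunov P phi f E0 + e)}.
Proof.
move=> e0; have e2 : 0 < e / 2 by rewrite divr_gt0.
have [n0 hn0] := lyapunov_approx P phi f phi_meas f_meas M M0 fM E0 _ e2.
set n := n0.+1 in hn0; have nR : 0 < n%:R :> R by rewrite ltr0n.
set l := lyapunov P phi f E0 in hn0 *.
pose K := `|E0| + 1; have := normr_ge0 E0; move=> E00.
pose L := M + K + 2; have L1 : 1 <= L by rewrite /L /K; have := M0; lra.
have Ln0 : 0 < L ^+ n by rewrite exprn_gt0//; lra.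
(* The bound 1 keeps [E] in [[- K, K]]; the other makes the Lipschitz error at time [n] at most
   [n%:R * (e / 2)]. The other half of [e] was spent in choosing [n]. *)
exists (Num.min 1 (e / 2 / L ^+ n)).
  by rewrite lt_min ltr01 divr_gt0.
have hK w : `|log_transfer phi f E0 n w| <= n%:R * ln (M + `|E0| + 2).
  exact: normr_log_transfer_le.
have mh := measurable_log_transfer phi f phi_meas f_meas E0 n.
apply: filterS (birkhoff_sum_le P phi phi_meas phi_pres phi_ergodic _ _ _ mh hK hn0).
(* The constants of the subadditive and ergodic bounds, divided by the window length [n]. *)
move=> w [C hC]; exists (2 * n%:R * ln L + n%:R^-1 * C) => E N.
rewrite le_min => /andP[Er1 Er2].
have EK : `|E| <= K.
  by have := lerB_dist E E0; rewrite /K; lra.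
have E0K : `|E0| <= K by rewrite /K; lra.
have bnd m v : 0 <= log_transfer phi f E m v <= m%:R * ln L.
  by rewrite log_transfer_ge0 log_transfer_le.
have := subadditive_le_sum phi (log_transfer phi f E) (ln L)
  (log_transfer_subadditive phi f E) bnd n N w.
have step v : log_transfer phi f E n v <= log_transfer phi f E0 n v + n%:R * (e / 2).
  apply: le_trans (log_transfer_lipschitz phi f M M0 fM K E E0 n v EK E0K) _.
  rewrite lerD2l -mulrA ler_wpM2l//.
  by rewrite mulrC -ler_pdivlMr.
have sumle : \sum_(i < N) log_transfer phi f E n (iter i phi w) <=
    C + N%:R * (n%:R * (l + e / 2)) + N%:R * (n%:R * (e / 2)).
  apply: le_trans (_ : \sum_(i < N) (log_transfer phi f E0 n (iter i phi w) + n%:R * (e / 2)) <= _).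
    by apply: ler_sum => i _; exact: step.
  by rewrite big_split/= sumr_const card_ord lerD ?hC// [leRHS]mulr_natl.
move=> h; rewrite -(ler_pM2l nR) (le_trans h)//.
rewrite (le_trans (lerD (lexx _) sumle))//.
have nV : n%:R * (n%:R^-1 * C) = C by rewrite mulrA divff ?mul1r// gt_eqF.
by rewrite ![in leRHS]mulrDr nV; lra.
Qed.

Lemma decay_seq_limsup E0 : {ae P, forall w,
  (limn_esup (fun N => (decay_seq phi f w N)%:E) <= (2 * lyapunov P phi f E0)%:E)%E}.
Proof.
(* Only the tolerances [k.+1%:R^-1] are used, so that countably many null sets have to be
   discarded. *)
have : {ae P, forall w, forall k : nat, exists C : R, forall m, (0 < m)%N ->
    decay_seq phi f w m <= 2 * lyapunov P phi f E0 + 2 * k.+1%:R^-1 + C / m%:R}.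
  apply: ae_foralln => k.
  have k0 : 0 < k.+1%:R^-1 :> R by rewrite invr_gt0 ltr0n.
  have [r r0] := log_transfer_near_le E0 _ k0.
  set l := lyapunov _ _ _ _; set e := k.+1%:R^-1.
  (* This is the part of -log(2 r exp(-2C - 2m(l + e))) that does not grow with [m]. *)
  apply: filterS => w [C hC]; exists (2 * C - ln (2 * r)) => m m0.
  have mR : 0 < m%:R :> R by rewrite ltr0n.
  have [D D1 ID] := Ical_le phi f M M0 fM.
  have lo := Ical_ge phi f E0 r (C + m%:R * (l + e)) m w r0 (fun E => hC E m).
  have up := ID m w m0.
  have Ifin : Ical phi f m w \is a fin_num.
    by rewrite fin_numElt (lt_le_trans (ltNyr _) lo) (le_lt_trans up (ltry _)).
  move: lo; rewrite -(fineK Ifin) lee_fin /decay_seq.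
  set I := fine _ => lo.
  have r2 : 0 < 2 * r by rewrite mulr_gt0.
  have I0 : 0 < I by rewrite (lt_le_trans _ lo)// mulr_gt0// expR_gt0.
  have : ln (2 * r) - 2 * (C + m%:R * (l + e)) <= ln I.
    rewrite -[X in _ + X]expRK -lnM ?posrE ?expR_gt0//.
    by rewrite ler_ln ?posrE ?mulr_gt0 ?expR_gt0.
  move=> lnI; rewrite -mulrN ler_pdivrMl// mulrDr mulrCA divff ?gt_eqF// mulr1.
  lra.
apply: filterS => w h; apply: limn_esup_le => e e0.
pose k := Num.trunc (2 / e).
have [C hC] := h k; exists C => m m0; apply: (le_trans (hC m m0)).
rewrite lerD2r lerD2l ler_pdivrMr ?ltr0n// mulrC -ler_pdivrMr// ltW//.
exact: truncnS_gt.
Qed.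

(** The upper bound on the integral is uniform in [N] and [w], so this holds at every point; it is
    proved as a limsup bound for the negated sequence. *)
Lemma decay_seq_liminf w : (0 <= limn_einf (fun N => (decay_seq phi f w N)%:E))%E.
Proof.
have [D D1 ID] := Ical_le phi f M M0 fM.
rewrite /limn_einf oppe_ge0.
apply: (@limn_esup_le R (fun N => - decay_seq phi f w N) 0) => e e0.
exists (ln D) => m m0; rewrite add0r opprK mulrC.
have I0 : (0 <= Ical phi f m w)%E.
  by apply: integral_ge0 => E _; rewrite lee_fin invr_ge0 sqr_ge0.
have Ifin : Ical phi f m w \is a fin_num.
  by rewrite fin_numElt (lt_le_trans (ltNyr 0) I0) (le_lt_trans (ID m w m0) (ltry _)).
have ID' : fine (Ical phi f m w) <= D by rewrite -lee_fin fineK// ID.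
have lnD : ln (fine (Ical phi f m w)) <= ln D.
  (* At a nonpositive argument [ln] takes its default value 0, and [1 <= D] gives [0 <= ln D]. *)
  have [Ip|In] := ltP 0 (fine (Ical phi f m w)).
    by rewrite ler_ln ?posrE//; lra.
  by rewrite (le_trans (ln_le0 _)) ?ln_ge0//; lra.
have : ln (fine (Ical phi f m w)) / m%:R <= ln D / m%:R by rewrite ler_wpM2r.
lra.
Qed.

End DecayRate.

Theorem theorem3p8 (R : realType) (d : measure_display) (Omega : measurableType d)
  (P : probability Omega R) (phi phiinv : Omega -> Omega) (f : Omega -> R)
  (phi_meas : measurable_fun [set: Omega] phi)
  (phiinv_meas : measurable_fun [set: Omega] phiinv)
  (phiK : cancel phi phiinv) (phiinvK : cancel phiinv phi)
  (phi_pres : forall A : set Omega, measurable A -> P (phi @^-1` A) = P A)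
  (phi_ergodic : forall A : set Omega, measurable A -> phi @^-1` A = A ->
                   P A = 0%E \/ P A = 1%E)
  (f_meas : measurable_fun [set: Omega] f)
  (f_bdd : exists M : R, forall w, `|f w| <= M)
  (L_cont : continuous (lyapunov P phi f)) :
  exists E0 : R,
    (forall E : R, lyapunov P phi f E0 <= lyapunov P phi f E) /\
    {ae P, forall w : Omega,
      [/\ (0 <= limn_einf (fun N => (decay_seq phi f w N)%:E))%E,
          (limn_einf (fun N => (decay_seq phi f w N)%:E)
             <= limn_esup (fun N => (decay_seq phi f w N)%:E))%E &
          (limn_esup (fun N => (decay_seq phi f w N)%:E)
             <= (2 * lyapunov P phi f E0)%:E)%E]}.
Proof.
have [M0 fM0] := f_bdd.
have M_ge0 : 0 <= `|M0| by [].
have fM w : `|f w| <= `|M0| by rewrite (le_trans (fM0 w))// ler_norm.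
have [E0 hE0] := lyapunov_min P phi f phi_meas f_meas `|M0| M_ge0 fM L_cont.
exists E0; split => //.
apply: filterS (decay_seq_limsup P phi f phi_meas phi_pres phi_ergodic f_meas
  `|M0| M_ge0 fM E0) => w hw; split => //; last exact: limn_einf_sup.
exact: (decay_seq_liminf phi f `|M0| M_ge0 fM w).
Qed.
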